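(* The category $\mathbf{pos}$ of finite posets has lax colimits indexed by finite posets, and they are described by the cylinder functor. Precisely: for every finite poset $P$, every functor $\mathcal{X}\colon P\to\mathbf{pos}^{\mathrm{op}}$ and every finite poset $Y$, there is an isomorphism of categories $$\mathrm{Hom}_{\mathbf{pos}}(\mathrm{Cyl}(\mathcal{X}),Y)\;\overset{\sim}{\longrightarrow}\;\mathrm{Hom}_{\mathbf{pos}^{\mathrm{op}}\text{-}\mathbf{data}^{\mathrm{Lax}}}(\mathcal{X},Y),$$ functorial in $\mathcal{X}$ and $Y$. In other words, $\mathrm{Cyl}$ coincides up to natural isomorphism with the lax sections functor (lax colimit functor) of the inclusion sending a poset $Y$ to the one-point datum with value $Y$.
   Context: $\mathbf{pos}$ is the strict 2-category of finite posets, monotone maps, and a unique 2-morphism $f\to g$ exactly when $f\le g$ pointwise; so $\mathrm{Hom}_{\mathbf{pos}}(X,Y)$ is a poset, seen as a category. A $\mathbf{pos}^{\mathrm{op}}$-datum is a pair of a finite poset $P=|\mathcal{X}|$ and a functor $\mathcal{X}\colon P\to\mathbf{pos}^{\mathrm{op}}$, i.e. posets $\mathcal{X}(p)$ and monotone maps $\mathcal{X}_{pq}\colon\mathcal{X}(q)\to\mathcal{X}(p)$ for $p\le q$, with $\mathcal{X}_{pp}=\mathrm{id}$ and $\mathcal{X}_{pq}\circ\mathcal{X}_{qr}=\mathcal{X}_{pr}$. A morphism of data $\mathcal{X}\to\mathcal{X}'$ is a monotone map $\varphi\colon|\mathcal{X}|\to|\mathcal{X}'|$ with monotone maps $\varphi_p\colon\mathcal{X}(p)\to\mathcal{X}'(\varphi(p))$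 such that $\varphi_p\circ\mathcal{X}_{pq}=\mathcal{X}'_{\varphi(p)\varphi(q)}\circ\varphi_q$ for $p\le q$. The cylinder $\mathrm{Cyl}(\mathcal{X})$ is the set $\coprod_{p\in P}\mathcal{X}(p)$ with the partial order: for $x_p\in\mathcal{X}(p)$, $y_q\in\mathcal{X}(q)$, $x_p\le y_q$ if and only if $p\le q$ and $x_p\le\mathcal{X}_{pq}(y_q)$ in $\mathcal{X}(p)$. On morphisms of data, $\mathrm{Cyl}(\varphi)(x_p)=\varphi_p(x_p)$. A poset $Y$ is regarded as the datum with one-point underlying poset and value $Y$. The category $\mathrm{Hom}_{\mathbf{pos}^{\mathrm{op}}\text{-}\mathbf{data}^{\mathrm{Lax}}}(\mathcal{X},Y)$ is the poset of lax natural transformations: families of monotone maps $\{f_p\colon\mathcal{X}(p)\to Y\}_{p\in P}$ such that $f_p\circ\mathcal{X}_{pq}\le f_q$ for all $p\le q$, ordered by $\{f_p\}\le\{g_p\}$ if and only if $f_p\le g_p$ for all $p\in P$. *)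

(* Defs.v *)
From HB Require Import structures.
From mathcomp Require Import all_boot all_order.
From mathcomp Require Import boolp.

Set Implicit Arguments.
Unset Strict Implicit.
Unset Printing Implicit Defensive.

Import Order.TTheory.
Local Open Scope order_scope.

(* Objects of [pos].  The display of a MathComp order is only a notation tag; it
   is bundled so that a [pos] is a finite poset carrying any display. *)
Structure pos := Pos {
  pos_disp : Order.disp_t;
  pos_sort :> finPOrderType pos_disp }.

Definition hom (X Y : pos) := {omorphism X -> Y}.

Definition hom_id (X : pos) : hom X X := idfun : {omorphism X -> X}.

Definition hom_comp (X Y Z : pos) (g : hom Y Z) (f : hom X Y) : hom X Z :=
  (g : {omorphism Y -> Z}) \o (f : {omorphism X -> Y}) : {omorphism X -> Z}.

Lemma hom_eqP (X Y : pos) (f g : hom X Y) : f =1 g -> f = g.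
Proof.
case: f g => [f [[fP]]] [g [[gP]]] /= /funext fg.
by case: _ / fg in gP *; rewrite (Prop_irrelevance fP gP).
Qed.

HB.instance Definition _ (X Y : pos) := gen_eqMixin (hom X Y).
HB.instance Definition _ (X Y : pos) := gen_choiceMixin (hom X Y).

Fact hom_display : Order.disp_t. Proof. exact: (Order.Disp tt tt). Qed.

Definition hom_le (X Y : pos) (f g : hom X Y) : bool :=
  [forall x, f x <= g x].

Lemma hom_le_refl (X Y : pos) : reflexive (@hom_le X Y).
Proof. by move=> f; apply/forallP. Qed.

Lemma hom_le_anti (X Y : pos) : antisymmetric (@hom_le X Y).
Proof.
move=> f g /andP[/forallP fg /forallP gf]; apply: hom_eqP => x.
by apply: le_anti; rewrite fg gf.
Qed.

Lemma hom_le_trans (X Y : pos) : transitive (@hom_le X Y).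
Proof.
move=> g f h /forallP fg /forallP gh; apply/forallP => x.
exact: le_trans (fg x) (gh x).
Qed.

HB.instance Definition _ (X Y : pos) :=
  Order.Le_isPOrder.Build hom_display (hom X Y)
    (@hom_le_refl X Y) (@hom_le_anti X Y) (@hom_le_trans X Y).

(* Between posets seen as categories, functors are monotone maps, so an
   isomorphism of categories is a pair of mutually inverse monotone maps. *)
Record poset_iso d d' (A : porderType d) (B : porderType d') := PosetIso {
  iso_fun :> {omorphism A -> B};
  iso_inv : {omorphism B -> A};
  iso_funK : cancel iso_fun iso_inv;
  iso_invK : cancel iso_inv iso_fun }.

(* A functor P -> pos^op.  The map [fibre_map X pq], for pq : p <= q, is X_pq and
   goes from X(q) to X(p). *)
Record datum := Datum {
  base : pos;
  fibre :> base -> pos;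
  fibre_map : forall p q : base, p <= q -> hom (fibre q) (fibre p);
  fibre_map_id : forall (p : base) (pp : p <= p),
    fibre_map pp = hom_id (fibre p);
  fibre_map_comp : forall (p q r : base) (pq : p <= q) (qr : q <= r)
    (pr : p <= r), hom_comp (fibre_map pq) (fibre_map qr) = fibre_map pr }.

Record data_hom (X X' : datum) := DataHom {
  base_hom : hom (base X) (base X');
  fibre_hom : forall p : base X, hom (X p) (X' (base_hom p));
  fibre_hom_nat : forall (p q : base X) (pq : p <= q)
    (fpq : base_hom p <= base_hom q),
    hom_comp (fibre_hom p) (fibre_map pq) =
    hom_comp (fibre_map fpq) (fibre_hom q) }.

Lemma data_id_nat (X : datum) (p q : base X) (pq : p <= q)
    (fpq : hom_id (base X) p <= hom_id (base X) q) :
  hom_comp (hom_id (X p)) (fibre_map pq) =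
  hom_comp (fibre_map fpq) (hom_id (X q)).
Proof. by apply: hom_eqP => x /=; rewrite (bool_irrelevance pq fpq). Qed.

Definition data_id (X : datum) : data_hom X X :=
  @DataHom X X (hom_id (base X)) (fun p => hom_id (X p)) (@data_id_nat X).

Lemma data_comp_nat (X X' X'' : datum) (psi : data_hom X' X'')
    (phi : data_hom X X') (p q : base X) (pq : p <= q)
    (fpq : hom_comp (base_hom psi) (base_hom phi) p <=
           hom_comp (base_hom psi) (base_hom phi) q) :
  hom_comp (hom_comp (fibre_hom psi (base_hom phi p)) (fibre_hom phi p))
    (fibre_map pq) =
  hom_comp (fibre_map fpq)
    (hom_comp (fibre_hom psi (base_hom phi q)) (fibre_hom phi q)).
Proof.
have pq' : base_hom phi p <= base_hom phi q by exact: omorph_le.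
apply: hom_eqP => x /=.
have /(congr1 (fun f : hom _ _ => f x)) /= -> := fibre_hom_nat pq pq'.
by have /(congr1 (fun f : hom _ _ => f (fibre_hom phi q x))) :=
  fibre_hom_nat pq' fpq.
Qed.

Definition data_comp (X X' X'' : datum) (psi : data_hom X' X'')
    (phi : data_hom X X') : data_hom X X'' :=
  @DataHom X X'' (hom_comp (base_hom psi) (base_hom phi))
    (fun p => hom_comp (fibre_hom psi (base_hom phi p)) (fibre_hom phi p))
    (@data_comp_nat X X' X'' psi phi).

Definition cyl (X : datum) : Type := {p : base X & X p}.
HB.instance Definition _ (X : datum) := Finite.on (cyl X).

Fact cyl_display : Order.disp_t. Proof. exact: (Order.Disp tt tt). Qed.

Definition cyl_le (X : datum) (x y : cyl X) : bool :=
  `[< exists pq : tag x <= tag y, tagged x <= fibre_map pq (tagged y) >].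

Lemma cyl_le_refl (X : datum) : reflexive (@cyl_le X).
Proof.
by move=> x; apply/asboolP; exists (lexx (tag x)); rewrite fibre_map_id.
Qed.

Lemma cyl_le_anti (X : datum) : antisymmetric (@cyl_le X).
Proof.
move=> [p x] [q y] /andP[/asboolP[/= pq xy] /asboolP[/= qp yx]].
have epq : p = q by apply: le_anti; rewrite pq qp.
case: _ / epq in y pq qp xy yx *.
rewrite !fibre_map_id /= in xy yx.
by congr Tagged; apply: le_anti; rewrite xy yx.
Qed.

Lemma cyl_le_trans (X : datum) : transitive (@cyl_le X).
Proof.
move=> [q y] [p x] [r z] /asboolP[/= pq xy] /asboolP[/= qr yz].
apply/asboolP; exists (le_trans pq qr) => /=.
rewrite -(fibre_map_comp pq qr) /=.
exact: le_trans xy (omorph_le _ yz).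
Qed.

HB.instance Definition _ (X : datum) :=
  Order.Le_isPOrder.Build cyl_display (cyl X)
    (@cyl_le_refl X) (@cyl_le_anti X) (@cyl_le_trans X).

Definition cyl_pos (X : datum) : pos := @Pos cyl_display (cyl X).

Definition cyl_fun (X X' : datum) (phi : data_hom X X')
    (x : cyl_pos X) : cyl_pos X' :=
  Tagged (fun p => X' p) (fibre_hom phi (tag x) (tagged x)).

Lemma cyl_fun_le (X X' : datum) (phi : data_hom X X') :
  {homo cyl_fun phi : x y / x <= y}.
Proof.
move=> [p x] [q y] /asboolP[/= pq xy]; apply/asboolP => /=.
have fpq : base_hom phi p <= base_hom phi q by exact: omorph_le.
exists fpq.
have /(congr1 (fun f : hom _ _ => f y)) /= <- := fibre_hom_nat pq fpq.
exact: omorph_le.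
Qed.

HB.instance Definition _ (X X' : datum) (phi : data_hom X X') :=
  Order.isOrderMorphism.Build _ (cyl_pos X) _ (cyl_pos X') (cyl_fun phi)
    (@cyl_fun_le X X' phi).

Definition cyl_map (X X' : datum) (phi : data_hom X X') :
    hom (cyl_pos X) (cyl_pos X') :=
  cyl_fun phi : {omorphism cyl_pos X -> cyl_pos X'}.

Lemma cyl_map_id (X : datum) : cyl_map (data_id X) = hom_id (cyl_pos X).
Proof. by apply: hom_eqP => -[p x]. Qed.

Lemma cyl_map_comp (X X' X'' : datum) (psi : data_hom X' X'')
    (phi : data_hom X X') :
  cyl_map (data_comp psi phi) = hom_comp (cyl_map psi) (cyl_map phi).
Proof. by apply: hom_eqP => -[p x]. Qed.

Record data_functor := DataFunctor {
  functor_obj :> datum -> pos;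
  functor_map : forall X X' : datum,
    data_hom X X' -> hom (functor_obj X) (functor_obj X');
  functor_map_id : forall X : datum,
    functor_map (data_id X) = hom_id (functor_obj X);
  functor_map_comp : forall (X X' X'' : datum) (psi : data_hom X' X'')
    (phi : data_hom X X'),
    functor_map (data_comp psi phi) =
    hom_comp (functor_map psi) (functor_map phi) }.

Definition Cyl : data_functor := DataFunctor cyl_map_id cyl_map_comp.

Definition natural_iso (L M : data_functor) : Prop :=
  exists (eta : forall X : datum, hom (L X) (M X))
         (theta : forall X : datum, hom (M X) (L X)),
    [/\ forall X : datum, hom_comp (theta X) (eta X) = hom_id (L X),
        forall X : datum, hom_comp (eta X) (theta X) = hom_id (M X)
      & forall (X X' : datum) (phi : data_hom X X'),
          hom_comp (eta X') (functor_map L phi) =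
          hom_comp (functor_map M phi) (eta X)].

(* Lax natural transformations from X to the one-point datum with value Y; the
   map from base X to the point is unique and is left out. *)
Record lax_hom (X : datum) (Y : pos) := LaxHom {
  lax_map :> forall p : base X, hom (X p) Y;
  lax_mapP : forall (p q : base X) (pq : p <= q),
    hom_comp (lax_map p) (fibre_map pq) <= lax_map q }.

Lemma lax_hom_eqP (X : datum) (Y : pos) (f g : lax_hom X Y) :
  (forall p, f p = g p) -> f = g.
Proof.
case: f g => [f fP] [g gP] /= efg.
have fg : f = g by apply: functional_extensionality_dep => p; exact: efg.
by case: _ / fg in gP efg *; rewrite (Prop_irrelevance fP gP).
Qed.

HB.instance Definition _ (X : datum) (Y : pos) := gen_eqMixin (lax_hom X Y).
HB.instance Definition _ (X : datum) (Y : pos) :=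
  gen_choiceMixin (lax_hom X Y).

Definition lax_le (X : datum) (Y : pos) (f g : lax_hom X Y) : bool :=
  [forall p, f p <= g p].

Lemma lax_le_refl (X : datum) (Y : pos) : reflexive (@lax_le X Y).
Proof. by move=> f; apply/forallP. Qed.

Lemma lax_le_anti (X : datum) (Y : pos) : antisymmetric (@lax_le X Y).
Proof.
move=> f g /andP[/forallP fg /forallP gf]; apply: lax_hom_eqP => p.
by apply: le_anti; rewrite fg gf.
Qed.

Lemma lax_le_trans (X : datum) (Y : pos) : transitive (@lax_le X Y).
Proof.
move=> g f h /forallP fg /forallP gh; apply/forallP => p.
exact: le_trans (fg p) (gh p).
Qed.

HB.instance Definition _ (X : datum) (Y : pos) :=
  Order.Le_isPOrder.Build hom_display (lax_hom X Y)
    (@lax_le_refl X Y) (@lax_le_anti X Y) (@lax_le_trans X Y).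

Lemma lax_pre_subproof (X X' : datum) (Y : pos) (f : lax_hom X' Y)
    (phi : data_hom X X') (p q : base X) (pq : p <= q) :
  hom_comp (hom_comp (f (base_hom phi p)) (fibre_hom phi p)) (fibre_map pq)
    <= hom_comp (f (base_hom phi q)) (fibre_hom phi q).
Proof.
have fpq : base_hom phi p <= base_hom phi q by exact: omorph_le.
apply/forallP => x /=.
have /(congr1 (fun f : hom _ _ => f x)) /= -> := fibre_hom_nat pq fpq.
by have /forallP/(_ (fibre_hom phi q x)) := lax_mapP f fpq.
Qed.

Definition lax_pre (X X' : datum) (Y : pos) (f : lax_hom X' Y)
    (phi : data_hom X X') : lax_hom X Y :=
  LaxHom (lax_pre_subproof f phi).

Lemma lax_post_subproof (X : datum) (Y Y' : pos) (h : hom Y Y')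
    (f : lax_hom X Y) (p q : base X) (pq : p <= q) :
  hom_comp (hom_comp h (f p)) (fibre_map pq) <= hom_comp h (f q).
Proof.
apply/forallP => x /=; apply: omorph_le.
by have /forallP/(_ x) := lax_mapP f pq.
Qed.

Definition lax_post (X : datum) (Y Y' : pos) (h : hom Y Y')
    (f : lax_hom X Y) : lax_hom X Y' :=
  LaxHom (lax_post_subproof h f).

(* L is left adjoint, in the sense of Hom-posets, to the inclusion of [pos] in
   data with lax morphisms that sends Y to the one-point datum with value Y. *)
Definition lax_colimit_functor (L : data_functor) : Prop :=
  exists Phi : forall (X : datum) (Y : pos),
      poset_iso (hom (L X) Y) (lax_hom X Y),
    (forall (X X' : datum) (phi : data_hom X X') (Y : pos)
            (f : hom (L X') Y),
       Phi X Y (hom_comp f (functor_map L phi)) = lax_pre (Phi X' Y f) phi) /\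
    (forall (X : datum) (Y Y' : pos) (h : hom Y Y') (f : hom (L X) Y),
       Phi X Y' (hom_comp h f) = lax_post h (Phi X Y f)).

(* Main.v *)
(** A monotone map out of the cylinder is the same as a family of maps on the
fibres; testing monotonicity on the generating inequalities
[X_pq y_q <= y_q] gives exactly the lax condition.  Uniqueness of the lax
colimit functor is the Yoneda argument: a family [Phi] natural in [Y] is
determined by the universal cocones [Phi X (L X) id]. *)

From HB Require Import structures.
From mathcomp Require Import all_boot all_order.
From mathcomp Require Import boolp.
Require Import Defs.

Set Implicit Arguments.
Unset Strict Implicit.
Unset Printing Implicit Defensive.

Import Order.TTheory.
Local Open Scope order_scope.

Lemma hom_comp1 (X Y : pos) (f : hom X Y) : hom_comp f (hom_id X) = f.
Proof. exact: hom_eqP. Qed.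

Lemma hom_1comp (X Y : pos) (f : hom X Y) : hom_comp (hom_id Y) f = f.
Proof. exact: hom_eqP. Qed.

Definition cyl_in_fun (X : datum) (p : base X) (x : X p) : cyl_pos X :=
  Tagged (fun p => X p) x.

Lemma cyl_in_le (X : datum) (p : base X) :
  {homo @cyl_in_fun X p : x y / x <= y}.
Proof.
by move=> x y xy; apply/asboolP; exists (lexx p); rewrite fibre_map_id.
Qed.

HB.instance Definition _ (X : datum) (p : base X) :=
  Order.isOrderMorphism.Build _ (X p) _ (cyl_pos X) (@cyl_in_fun X p)
    (@cyl_in_le X p).

Definition cyl_in (X : datum) (p : base X) : hom (X p) (cyl_pos X) :=
  @cyl_in_fun X p : {omorphism X p -> cyl_pos X}.

(** In the cylinder order, [X_pq x <= x] unfolds to reflexivity in the fibre over [p]. *)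
Lemma cyl_in_lax (X : datum) (p q : base X) (pq : p <= q) :
  hom_comp (cyl_in p) (fibre_map pq) <= cyl_in q.
Proof. by apply/forallP => x; apply/asboolP; exists pq. Qed.

Definition cyl_cocone (X : datum) : lax_hom X (cyl_pos X) :=
  LaxHom (@cyl_in_lax X).

Definition cyl_desc_fun (X : datum) (Y : pos) (f : lax_hom X Y)
  (x : cyl_pos X) : Y := f (tag x) (tagged x).

(** Any [x <= y] in the cylinder factors as [x <= X_pq y] inside the fibre over [p], preserved since
    [f p] is monotone, followed by [X_pq y <= y], preserved by laxness. *)
Lemma cyl_desc_le (X : datum) (Y : pos) (f : lax_hom X Y) :
  {homo cyl_desc_fun f : x y / x <= y}.
Proof.
move=> [p x] [q y] /asboolP[/= pq xy].
have /forallP/(_ y) fpq := lax_mapP f pq.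
exact: le_trans (omorph_le (f p) xy) fpq.
Qed.

HB.instance Definition _ (X : datum) (Y : pos) (f : lax_hom X Y) :=
  Order.isOrderMorphism.Build _ (cyl_pos X) _ Y (cyl_desc_fun f)
    (@cyl_desc_le X Y f).

Definition cyl_desc (X : datum) (Y : pos) (f : lax_hom X Y) :
    hom (cyl_pos X) Y :=
  cyl_desc_fun f : {omorphism cyl_pos X -> Y}.

(** In this form, naturality in [Y] is just associativity of composition. *)
Definition cyl_restr (X : datum) (Y : pos) (f : hom (cyl_pos X) Y) :
  lax_hom X Y := lax_post f (cyl_cocone X).

Lemma cyl_restr_le (X : datum) (Y : pos) :
  {homo @cyl_restr X Y : f g / f <= g}.
Proof.
by move=> f g /forallP fg; apply/forallP => p; apply/forallP => x; apply: fg.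
Qed.

Lemma cyl_desc_mono (X : datum) (Y : pos) :
  {homo @cyl_desc X Y : f g / f <= g}.
Proof.
move=> f g /forallP fg; apply/forallP => -[p x].
by have /forallP/(_ x) := fg p.
Qed.

HB.instance Definition _ (X : datum) (Y : pos) :=
  Order.isOrderMorphism.Build _ (hom (cyl_pos X) Y) _ (lax_hom X Y)
    (@cyl_restr X Y) (@cyl_restr_le X Y).

HB.instance Definition _ (X : datum) (Y : pos) :=
  Order.isOrderMorphism.Build _ (lax_hom X Y) _ (hom (cyl_pos X) Y)
    (@cyl_desc X Y) (@cyl_desc_mono X Y).

Lemma cyl_restrK (X : datum) (Y : pos) :
  cancel (@cyl_restr X Y) (@cyl_desc X Y).
Proof. by move=> f; apply: hom_eqP => -[p x]. Qed.

Lemma cyl_descK (X : datum) (Y : pos) :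
  cancel (@cyl_desc X Y) (@cyl_restr X Y).
Proof. by move=> f; apply: lax_hom_eqP => p; apply: hom_eqP. Qed.

Definition cyl_iso (X : datum) (Y : pos) :
    poset_iso (hom (cyl_pos X) Y) (lax_hom X Y) :=
  @PosetIso _ _ (hom (cyl_pos X) Y) (lax_hom X Y)
    (@cyl_restr X Y) (@cyl_desc X Y) (@cyl_restrK X Y) (@cyl_descK X Y).

Lemma Cyl_lax_colimit : lax_colimit_functor Cyl.
Proof.
exists cyl_iso; split=> [X X' phi Y f | X Y Y' h f];
  by apply: lax_hom_eqP => p; apply: hom_eqP.
Qed.

Lemma lax_colimit_functor_unique (L M : data_functor) :
  lax_colimit_functor L -> lax_colimit_functor M -> natural_iso L M.
Proof.
move=> [F [Fpre Fpost]] [G [Gpre Gpost]].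
(* Each comparison map classifies the universal cocone of the other functor. *)
pose eta X : hom (L X) (M X) := iso_inv (F X (M X)) (G X (M X) (hom_id _)).
pose theta X : hom (M X) (L X) := iso_inv (G X (L X)) (F X (L X) (hom_id _)).
have Feta X : F X (M X) (eta X) = G X (M X) (hom_id _) by exact: iso_invK.
have Gtheta X : G X (L X) (theta X) = F X (L X) (hom_id _) by exact: iso_invK.
(* Yoneda: naturality in [Y] at the identity makes every cocone a pushforward of the universal
   one. *)
have postG X Y (h : hom (M X) Y) :
    lax_post h (G X (M X) (hom_id _)) = G X Y h.
  by rewrite -Gpost hom_comp1.
have postF X Y (h : hom (L X) Y) :
    lax_post h (F X (L X) (hom_id _)) = F X Y h.
  by rewrite -Fpost hom_comp1.
exists eta, theta; split=> [X | X | X X' phi].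
(* Maps out of [L X] are compared through their cocones: both sides give the universal cocone of
   [L X]. *)
- by apply: (can_inj (iso_funK (F X (L X)))); rewrite Fpost Feta postG Gtheta.
- by apply: (can_inj (iso_funK (G X (M X)))); rewrite Gpost Gtheta postF Feta.
(* Naturality in [X] enters only here: both composites correspond to the cocone
   [G X (M X') (functor_map M phi)]. *)
- apply: (can_inj (iso_funK (F X (M X')))).
  by rewrite Fpre Fpost !Feta -Gpre postG hom_1comp.
Qed.

Theorem lemma5p2 :
  lax_colimit_functor Cyl /\
  (forall L : data_functor, lax_colimit_functor L -> natural_iso L Cyl).
Proof.
split=> [|L LP]; first exact: Cyl_lax_colimit.
exact: lax_colimit_functor_unique LP Cyl_lax_colimit.
Qed.
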